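(* Consider, for $J\in\mathbb{R}$, the two problems for a function $h$ on $\mathbb{R}$: (A) $\frac{h^2}{2}+h^3(\partial_\theta h+\partial_\theta^3h)=J$, with $h(\theta+2\pi)=h(\theta)$ for $\theta\in\mathbb{R}$; (B) $h^3(\partial_\theta h+\partial_\theta^3h)=J$, with $h(\theta+2\pi)=h(\theta)$ for $\theta\in\mathbb{R}$. Problem (A) has positive solutions $h\in C^3([0,2\pi])$ if and only if $J>0$. For any $J>0$ there is a constant solution of (A) given by $h(\theta)=\sqrt{2J}$. Moreover, for any $L>0$ there exists $\varepsilon=\varepsilon(L)>0$ such that for every $J$ with $\frac1L\le J\le L$ the only solution of (A) satisfying $\|h-\sqrt{2J}\|_{L^\infty(\mathbb{T})}<\varepsilon$ is $h(\theta)=\sqrt{2J}$. Problem (B) has positive solutions if and only if $J=0$. The corresponding solutions of (B) are given by $$h(\theta)=c_1+c_2\sin(\theta-\theta_0),$$ where $|c_2|<c_1$, with $c_1>0$, $c_2\in\mathbb{R}$ and $\theta_0\in\mathbb{R}$.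
   Context: $\mathbb{T}=\mathbb{R}/2\pi\mathbb{Z}$. Solutions $h$ are real-valued and, throughout, only positive functions $h>0$ are considered. *)

(* Defs.v *)
From HB Require Import structures.
From mathcomp Require Import all_boot all_order all_algebra.
From mathcomp Require Import all_classical all_reals all_analysis.

Set Implicit Arguments.
Unset Strict Implicit.
Unset Printing Implicit Defensive.

Import Order.TTheory GRing.Theory Num.Theory.
Import numFieldNormedType.Exports.

Local Open Scope classical_set_scope.
Local Open Scope ring_scope.

(* The derivability clause is needed because [derive1] is a total operator with
   a default value where the derivative does not exist. *)
Definition C3 (R : realType) (h : R -> R) : Prop :=
  (forall k, (k < 3)%N -> forall t : R, derivable (derive1n k h) t 1) /\
  continuous (derive1n 3 h).

(* Functions on the circle R/2piZ are 2pi-periodic functions on R; being C^3 up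
   to the ends of a period, with matching derivatives, is being C^3 on R. *)
Definition positive_C3_periodic (R : realType) (h : R -> R) : Prop :=
  [/\ C3 h, periodic h (2 * pi) & forall t : R, 0 < h t].

Definition solutionA (R : realType) (J : R) (h : R -> R) : Prop :=
  positive_C3_periodic h /\
  forall t : R, h t ^+ 2 / 2 + h t ^+ 3 * (derive1 h t + derive1n 3 h t) = J.

Definition solutionB (R : realType) (J : R) (h : R -> R) : Prop :=
  positive_C3_periodic h /\
  forall t : R, h t ^+ 3 * (derive1 h t + derive1n 3 h t) = J.

(* The L^oo norm on the circle, as the essential supremum for Lebesgue measure
   on one period. *)
Definition Linfty_circle (R : realType) (f : R -> R) : \bar R :=
  Lnorm (mrestr (@lebesgue_measure R) (measurable_itv `[0, 2 * pi]))
    +oo%E (EFin \o f).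

(* Main.v *)
(* A function that is monotone and periodic has zero derivative.  Applied to
   [h + h''], whose derivative [h' + h'''] is [J / h^3 - 1 / (2 h)] in (A) and
   [J / h^3] in (B), this forces [J > 0], respectively [J = 0].  Applied to
   [E = (h - c) h'' - h'^2 / 2 + (h - c)^2 / 2] with [c = sqrt (2 J)], for which
   [E' = (h - c) (h' + h''') = - (h - c)^2 (h + c) / (2 h^3)] in (A), it forces
   [h = c]: uniqueness holds among all positive solutions, not only near the
   constant.  For (B) with [J = 0], [h + h''] is constant, so [h] is a constant
   plus a solution of the harmonic oscillator. *)
Require Import Defs.
From HB Require Import structures.
From mathcomp Require Import all_boot all_order all_algebra.
From mathcomp Require Import all_classical all_reals all_analysis.
From mathcomp Require Import ring lra.

Set Implicit Arguments.
Unset Strict Implicit.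
Unset Printing Implicit Defensive.

Import Order.TTheory GRing.Theory Num.Theory.
Import numFieldNormedType.Exports.

Local Open Scope classical_set_scope.
Local Open Scope ring_scope.

(** * Derivatives of periodic and of $C^3$ functions *)

Lemma is_derive1E (R : realType) (f : R -> R) (t df : R) :
  is_derive t 1 f df -> derive1 f t = df.
Proof. by rewrite derive1E => /@derive_val. Qed.

Lemma periodic_derive1 (R : realType) (f : R -> R) (T : R) :
  periodic f T -> periodic (derive1 f) T.
Proof.
by move=> fT t; rewrite /derive1; under eq_fun do rewrite addrA !fT.
Qed.

Lemma periodic_derive1n (R : realType) (f : R -> R) (T : R) (n : nat) :
  periodic f T -> periodic (derive1n n f) T.
Proof.
by move=> fT; elim: n => // n IH; rewrite derive1nS; exact: periodic_derive1.
Qed.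

(** Here [f] is nonincreasing, and any [y] can be moved to the right of any [x] by whole periods
    without changing [f y]. Hence [f y <= f x] for all pairs, and exchanging the two points shows
    that [f] is constant. *)
Lemma periodic_le0_derive (R : realType) (f f' : R -> R) (T : R) :
  0 < T -> periodic f T -> (forall t : R, is_derive t 1 f (f' t)) ->
  (forall t, f' t <= 0) -> forall t, f' t = 0.
Proof.
move=> T0 fT df f'0.
have nincr x y : x <= y -> f y <= f x.
  move=> xy; apply: (@ler0_derive1_nincr R f x y) => //.
  - by move=> z _; rewrite (is_derive1E (df z)).
  - apply: continuous_subspaceT => z.
    exact/differentiable_continuous/derivable1_diffP.
have le x y : f y <= f x.
  pose n := Num.bound `|(x - y) / T|.
  have xn : x <= y + T *+ n.
    rewrite -lerBlDl -mulr_natl -ler_pdivrMr //.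
    by apply: le_trans (ler_norm _) _; apply/ltW/archi_boundP.
  by rewrite -(periodicn fT n y) nincr.
move=> t; rewrite -(is_derive1E (df t)).
have -> : f = cst (f t) by apply/funext => s; apply/eqP; rewrite eq_le !le.
exact: derive1_cst.
Qed.

Lemma C3_is_derive (R : realType) (h : R -> R) (t : R) :
  C3 h -> [/\ is_derive t 1 h (derive1 h t),
    is_derive t 1 (derive1 h) (derive1n 2 h t) &
    is_derive t 1 (derive1n 2 h) (derive1n 3 h t)].
Proof.
move=> [dh _]; split.
- by rewrite derive1E; exact/derivableP/(dh 0).
- by rewrite derive1nS derive1E; exact/derivableP/(dh 1).
- by rewrite (derive1nS h 2) derive1E; exact/derivableP/(dh 2).
Qed.

(** Meant for explicit solutions: a chain of derivatives given by hand yields both the regularity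
    and the derivative terms of the equation. *)
Lemma C3_of_is_derive (R : realType) (h h1 h2 h3 : R -> R) :
  (forall t : R, is_derive t 1 h (h1 t)) ->
  (forall t : R, is_derive t 1 h1 (h2 t)) ->
  (forall t : R, is_derive t 1 h2 (h3 t)) -> continuous h3 ->
  [/\ C3 h, derive1 h = h1 & derive1n 3 h = h3].
Proof.
move=> d0 d1 d2 c3.
have e1 : derive1 h = h1 by apply/funext => t; exact/is_derive1E.
have e2 : derive1 h1 = h2 by apply/funext => t; exact/is_derive1E.
have e3 : derive1 h2 = h3 by apply/funext => t; exact/is_derive1E.
rewrite /C3 /derive1n /= e1 e2 e3; split=> //; split=> //.
by case=> [|[|[|]]]//= _ t; rewrite ?e1 ?e2.
Qed.

(** * The sign of [J] in the two problems *)

Lemma periodic_curvature_rate_le0 (R : realType) (h : R -> R) (a : R) :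
  positive_C3_periodic h ->
  (forall t, a * (derive1 h t + derive1n 3 h t) <= 0) ->
  forall t, a * (derive1 h t + derive1n 3 h t) = 0.
Proof.
move=> [Ch ph _]; apply: (@periodic_le0_derive _
  (fun t => a * (h t + derive1n 2 h t)) _ (2 * pi)).
- by rewrite mulr_gt0// pi_gt0.
- by move=> t; rewrite ph (periodic_derive1n 2 ph).
- move=> t; have [d0 _ d2] := C3_is_derive t Ch.
  by apply: is_derive_eq.
Qed.

Lemma solutionA_gt0 (R : realType) (J : R) (h : R -> R) :
  solutionA J h -> 0 < J.
Proof.
move=> [Ph eqh]; have [_ _ h0] := Ph; rewrite ltNge; apply/negP => J0.
(* If [J <= 0], then $h^3 (h' + h''') = J - h^2/2$ is negative. *)
have lt0 t : derive1 h t + derive1n 3 h t < 0.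
  rewrite -(pmulr_rlt0 _ (exprn_gt0 3 (h0 t))).
  by have := eqh t; have := exprn_gt0 2 (h0 t); lra.
have le0 t : 1 * (derive1 h t + derive1n 3 h t) <= 0 by rewrite mul1r ltW.
have := periodic_curvature_rate_le0 Ph le0 0.
by move/eqP; rewrite mul1r lt_eqF.
Qed.

Lemma solutionB_eq0 (R : realType) (J : R) (h : R -> R) :
  solutionB J h -> J = 0.
Proof.
move=> [Ph eqh]; have [_ _ h0] := Ph.
(* The factor [- J] treats both signs of [J] at once: with $b = h' + h'''$ and $J = h^3 b$, one has
   $-J b = -h^3 b^2$. *)
have le0 t : - J * (derive1 h t + derive1n 3 h t) <= 0.
  rewrite -(eqh t); set b := _ + _.
  by have := mulr_ge0 (exprn_ge0 3 (ltW (h0 t))) (sqr_ge0 b); lra.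
have /eqP := periodic_curvature_rate_le0 Ph le0 0.
rewrite mulf_eq0 oppr_eq0 => /orP[/eqP//|/eqP rate0].
by rewrite -(eqh 0) rate0 mulr0.
Qed.

(** * Problem (A): the constant is the only solution *)

Lemma is_derive_energy (R : realType) (h h1 h2 : R -> R) (h3 c t : R) :
  is_derive t 1 h (h1 t) -> is_derive t 1 h1 (h2 t) -> is_derive t 1 h2 h3 ->
  is_derive t 1
    (fun s => (h s - c) * h2 s - h1 s ^+ 2 / 2 + (h s - c) ^+ 2 / 2)
    ((h t - c) * (h1 t + h3)).
Proof.
by move=> d0 d1 d2; apply: is_derive_eq; rewrite /GRing.scale /=; field.
Qed.

Lemma solutionA_cst (R : realType) (J : R) (h : R -> R) :
  solutionA J h -> h = (fun=> Num.sqrt (2 * J)).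
Proof.
move=> Sh; have J0 := solutionA_gt0 Sh; have [[Ch ph h0] eqh] := Sh.
set c := Num.sqrt _.
have c0 : 0 < c by rewrite sqrtr_gt0 mulr_gt0.
have cE : c ^+ 2 = 2 * J by rewrite sqr_sqrtr// mulr_ge0// ltW.
(* Since $J = c^2/2$, the numerator $J - h^2/2$ factors as $-(h - c)(h + c)/2$, which leaves a
   square times a positive weight. *)
have keyE t : (h t - c) * (derive1 h t + derive1n 3 h t) =
    - ((h t - c) ^+ 2 * ((h t + c) / (2 * h t ^+ 3))).
  have h0t := h0 t.
  have -> : derive1 h t + derive1n 3 h t = (J - h t ^+ 2 / 2) / h t ^+ 3.
    by rewrite -(eqh t); field; rewrite gt_eqF.
  have -> : J = c ^+ 2 / 2 by rewrite cE; field.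
  by field; rewrite gt_eqF.
have w0 t : 0 < (h t + c) / (2 * h t ^+ 3).
  by rewrite divr_gt0 ?addr_gt0 ?mulr_gt0 ?exprn_gt0.
have := @periodic_le0_derive _
  (fun t => (h t - c) * derive1n 2 h t - derive1 h t ^+ 2 / 2
            + (h t - c) ^+ 2 / 2)
  (fun t => (h t - c) * (derive1 h t + derive1n 3 h t)) (2 * pi).
have pi20 : 0 < 2 * pi :> R by rewrite mulr_gt0// pi_gt0.
move=> /(_ pi20) E0; apply/funext => t; apply/eqP.
(* As the weight is positive, $E'(t) = 0$ gives $(h(t) - c)^2 = 0$. The periodicity of $E$, its
   derivative and the sign of $E'$ are checked afterwards. *)
rewrite -subr_eq0 -sqrf_eq0; have := E0 _ _ _ t.
rewrite keyE => /(_ _ _ _)/eqP; rewrite oppr_eq0 mulf_eq0 (gt_eqF (w0 t)) orbF.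
apply.
- by move=> s; rewrite ph (periodic_derive1 ph) (periodic_derive1n 2 ph).
- move=> s; have [d0 d1 d2] := C3_is_derive s Ch.
  exact: is_derive_energy.
- by move=> s; rewrite keyE oppr_le0 mulr_ge0 ?sqr_ge0 ?ltW.
Qed.

Lemma solutionA_sqrt (R : realType) (J : R) :
  0 < J -> solutionA J (fun=> Num.sqrt (2 * J)).
Proof.
move=> J0; set c := Num.sqrt _.
have dcst k (t : R) : is_derive t 1 (fun _ : R => k) (0 : R).
  exact: is_derive_cst.
have [Cc e1 e3] :=
  C3_of_is_derive (dcst c) (dcst 0) (dcst 0) (@cst_continuous _ _ 0).
split; first by split=> // t; rewrite sqrtr_gt0 mulr_gt0.
move=> t; rewrite e1 e3 /= addr0 mulr0 addr0 sqr_sqrtr.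
  by field.
by rewrite mulr_ge0// ltW.
Qed.

(** * Problem (B): the shifted sines *)

Lemma harmonic_eq (R : realType) (f f' : R -> R) :
  (forall t : R, is_derive t 1 f (f' t)) ->
  (forall t : R, is_derive t 1 f' (- f t)) ->
  forall t, f t = f 0 * cos t + f' 0 * sin t.
Proof.
move=> d0 d1 t.
(* Rotating $(f, f')$ by the angle $s$ undoes the flow of the oscillator, so both coordinates are
   conserved; rotating back recovers [f]. *)
have dA (s : R) : is_derive s 1 (fun s => f s * cos s - f' s * sin s) 0.
  by apply: is_derive_eq; rewrite /GRing.scale /=; ring.
have dB (s : R) : is_derive s 1 (fun s => f s * sin s + f' s * cos s) 0.
  by apply: is_derive_eq; rewrite /GRing.scale /=; ring.
have := is_derive_0_is_cst t 0 dA; have := is_derive_0_is_cst t 0 dB.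
rewrite cos0 sin0 !mulr1 !mulr0 subr0 add0r => <- <-.
by rewrite -[LHS]mulr1 -(cos2Dsin2 t); ring.
Qed.

Lemma polar_coordinates (R : realType) (a b : R) :
  exists r t : R, a = r * cos t /\ b = r * sin t.
Proof.
pose r := Num.sqrt (a ^+ 2 + b ^+ 2).
have s0 : 0 <= a ^+ 2 + b ^+ 2 by rewrite addr_ge0 ?sqr_ge0.
have rE : r ^+ 2 = a ^+ 2 + b ^+ 2 by rewrite sqr_sqrtr.
have [r0|r0] := eqVneq r 0.
  exists 0, 0; rewrite !mul0r; move: rE; rewrite r0 expr0n/= => /esym/eqP.
  by rewrite paddr_eq0 ?sqr_ge0// !sqrf_eq0 => /andP[/eqP-> /eqP->].
have abs1 : -1 <= a / r <= 1.
  rewrite -ler_norml -(@expr_le1 _ 2)// -normrX ger0_norm ?sqr_ge0//.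
  rewrite expr_div_n rE ler_pdivrMr ?mul1r ?lerDl ?sqr_ge0//.
  by rewrite lt_neqAle s0 andbT eq_sym -rE sqrf_eq0.
have cosE : cos (acos (a / r)) = a / r by rewrite acosK// in_itv.
have sin2 : b ^+ 2 = (r * sin (acos (a / r))) ^+ 2.
  have -> : b ^+ 2 = r ^+ 2 - a ^+ 2 by rewrite rE; ring.
  by rewrite exprMn sin2cos2 cosE; field.
have aE : a = r * cos (acos (a / r)) by rewrite cosE; field.
(* The arccosine determines the angle only up to sign; the sign of [b] decides. *)
move/eqP: sin2; rewrite eqf_sqr => /orP[]/eqP bE.
  by exists r, (acos (a / r)).
by exists r, (- acos (a / r)); rewrite cosN sinN mulrN.
Qed.

Lemma solutionB_shape (R : realType) (h : R -> R) :
  solutionB 0 h ->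
  exists c1 c2 t0 : R,
    [/\ 0 < c1, `|c2| < c1 & forall t : R, h t = c1 + c2 * sin (t - t0)].
Proof.
move=> [[Ch _ h0] eqh].
have rate0 t : derive1 h t + derive1n 3 h t = 0.
  by have /eqP := eqh t; rewrite mulf_eq0 expf_eq0 (gt_eqF (h0 t)) => /eqP.
have dh t := C3_is_derive t Ch.
pose c := h 0 + derive1n 2 h 0.
have sumE t : h t + derive1n 2 h t = c.
  apply: (@is_derive_0_is_cst R (fun s => h s + derive1n 2 h s) t 0) => s.
  have [d0 _ d2] := dh s.
  by apply: is_derive_eq; rewrite rate0.
have hE : forall t, h t - c = (h 0 - c) * cos t + derive1 h 0 * sin t.
  apply: (@harmonic_eq R (fun t => h t - c) (derive1 h)) => t;
    have [d0 d1 _] := dh t.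
    by apply: is_derive_eq; rewrite subr0.
  by apply: is_derive_eq; rewrite -(sumE t); ring.
(* The sine coefficient comes first, to match $\sin(t + s) = \sin t \cos s + \cos t \sin s$. *)
have [r [s [bE aE]]] := polar_coordinates (derive1 h 0) (h 0 - c).
have {}hE t : h t = c + r * sin (t + s).
  by rewrite -[LHS](subrK c) hE aE bE sinD; ring.
(* Positivity of [h] where $\sin(t + s) = \pm 1$ gives $c \pm r > 0$. *)
have rc : `|r| < c.
  rewrite ltr_norml.
  have := h0 (pi / 2 - s); have := h0 (- (pi / 2) - s).
  by rewrite !hE !subrK sinN sin_pihalf; lra.
exists c, r, (- s); split=> //; first exact: le_lt_trans rc.
by move=> t; rewrite opprK.
Qed.

Lemma is_derive_shift (R : realType) (f : R -> R) (a df t : R) :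
  is_derive (t - a) 1 f df -> is_derive t 1 (fun s => f (s - a)) df.
Proof.
move=> d; have dt : is_derive t 1 (fun s => s - a) 1.
  by apply: is_derive_eq; rewrite subr0.
by have := @is_derive1_comp R f (fun s => s - a) t _ _ d dt; rewrite mulr1.
Qed.

Lemma solutionB_shifted_sin (R : realType) (c1 c2 t0 : R) :
  `|c2| < c1 -> solutionB 0 (fun t => c1 + c2 * sin (t - t0)).
Proof.
move=> c21.
have ds (t : R) : is_derive t 1 (fun t => sin (t - t0)) (cos (t - t0)).
  exact: is_derive_shift (is_derive_sin _).
have dc (t : R) : is_derive t 1 (fun t => cos (t - t0)) (- sin (t - t0)).
  exact: is_derive_shift (is_derive_cos _).
have d0 (t : R) : is_derive t 1 (fun t => c1 + c2 * sin (t - t0))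
    (c2 * cos (t - t0)).
  by apply: is_derive_eq; rewrite /GRing.scale /=; ring.
have d1 (t : R) :
    is_derive t 1 (fun t => c2 * cos (t - t0)) (- (c2 * sin (t - t0))).
  by apply: is_derive_eq; rewrite /GRing.scale /=; ring.
have d2 (t : R) :
    is_derive t 1 (fun t => - (c2 * sin (t - t0))) (- (c2 * cos (t - t0))).
  by apply: is_derive_eq; rewrite /GRing.scale /=; ring.
have c3 : continuous (fun t => - (c2 * cos (t - t0))).
  move=> t; apply/differentiable_continuous/derivable1_diffP.
  exact: ex_derive.
have [Ch e1 e3] := C3_of_is_derive d0 d1 d2 c3.
split; last by move=> t; rewrite e1 e3 addrN mulr0.
split=> // t.
  by rewrite addrAC mulr_natl sinD2pi.
(* Positivity: the oscillation never exceeds [|c2|], which is below [c1]. *)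
have : `|c2 * sin (t - t0)| <= `|c2|.
  by rewrite normrM ler_piMr// ler_norml sin_geN1 sin_le1.
by move=> /ler_normlP[]; lra.
Qed.

Lemma Linfty_circle0 (R : realType) :
  Linfty_circle (fun _ : R => 0 : R) = 0%E.
Proof. exact: Lnorm0. Qed.

Theorem proposition4p1 (R : realType) :
  (forall J : R, (exists h : R -> R, solutionA J h) <-> 0 < J)
  /\
  (forall J : R, 0 < J -> solutionA J (fun _ : R => Num.sqrt (2 * J)))
  /\
  (forall L : R, 0 < L ->
     exists2 eps : R, 0 < eps &
       forall J : R, L^-1 <= J <= L ->
       forall h : R -> R,
         (solutionA J h /\
          (Linfty_circle (fun t : R => (h t - Num.sqrt (2 * J))%R) < eps%:E)%E)
         <-> h = (fun _ : R => Num.sqrt (2 * J)))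
  /\
  (forall J : R, (exists h : R -> R, solutionB J h) <-> J = 0)
  /\
  (forall h : R -> R,
     solutionB 0 h <->
     exists c1 c2 t0 : R,
       [/\ 0 < c1, `|c2| < c1 & forall t : R, h t = c1 + c2 * sin (t - t0)]).
Proof.
split=> [J|]; first split=> [[h] /solutionA_gt0//|J0].
  by exists (fun=> Num.sqrt (2 * J)); exact: solutionA_sqrt.
split; first exact: solutionA_sqrt.
split=> [L L0|].
  (* Uniqueness is global, so the radius 1 serves for every [L]. *)
  exists 1 => // J /andP[LJ _] h; split=> [[Sh _]|->].
    exact: solutionA_cst Sh.
  have J0 : 0 < J by apply: lt_le_trans LJ; rewrite invr_gt0.
  split; first exact: solutionA_sqrt.
  under [X in Linfty_circle X]funext => t do rewrite subrr.
  by rewrite Linfty_circle0 lte01.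
have shape (h : R -> R) : solutionB 0 h <-> exists c1 c2 t0 : R,
    [/\ 0 < c1, `|c2| < c1 & forall t : R, h t = c1 + c2 * sin (t - t0)].
  split=> [|[c1 [c2 [t0 [_ c21 hE]]]]]; first exact: solutionB_shape.
  by rewrite (funext hE); exact: solutionB_shifted_sin.
split=> // J; split=> [[h] /solutionB_eq0//|->].
(* The constant 1 is the member of the family with zero amplitude. *)
exists (cst 1); apply/shape; exists 1, 0, 0; split; rewrite ?normr0// => t.
by rewrite mul0r addr0.
Qed.
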